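(* Let $K$ be a field, let $A$, $B$, $C$ be $K$-algebras with $B$ and $C$ finite dimensional, and let $D:=B\times C$. Let $i_B\colon B\to D$, $i_C\colon C\to D$ be the canonical inclusions and $p_B\colon D\to B$, $p_C\colon D\to C$ the canonical surjections. Let $\psi\colon A\otimes D\to D\otimes A$ be a $K$-linear map and suppose that both maps $\Theta:=(p_B\otimes A)\circ\psi\circ(A\otimes i_B)$ and $\Upsilon:=(p_C\otimes A)\circ\psi\circ(A\otimes i_C)$ are twisting maps. Then $\psi$ is a twisting map if and only if $\psi=\Theta\oplus\Upsilon$.
   Context: Algebras are associative and unital, all maps are $K$-linear, $\otimes=\otimes_K$, and an algebra used as a map denotes its identity map. A twisting map for algebras $A$, $B$ is a $K$-linear map $\chi\colon A\otimes B\to B\otimes A$ such that $\chi(1\otimes b)=b\otimes1$, $\chi(a\otimes1)=1\otimes a$ for all $a,b$; $\chi\circ(\mu_A\otimes B)=(B\otimes\mu_A)\circ(\chi\otimes A)\circ(A\otimes\chi)$; and $\chi\circ(A\otimes\mu_B)=(\mu_B\otimes A)\circ(B\otimes\chi)\circ(\chi\otimes B)$, where $\mu$ denotes multiplication. The inclusions $i_B(b)=(b,0)$ and $i_C(c)=(0,c)$ are linear and multiplicative but not unital. Under the identifications $A\otimes D=(A\otimes B)\oplus(A\otimes C)$ and $D\otimes A=(B\otimes A)\oplus(C\otimes A)$, $\Theta\oplus\Upsilon$ is the map $A\otimes D\to D\otimes A$ given by $a\otimes(b,c)\mapsto (i_B\otimes A)(\Theta(a\otimes b))+(i_C\otimes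 A)(\Upsilon(a\otimes c))$. *)

(* Defs.v *)
From HB Require Import structures.
From mathcomp Require Import all_boot all_algebra.
From mathcomp Require Import boolp.
From mathcomp Require Import freeg.

Set Implicit Arguments.
Unset Strict Implicit.
Unset Printing Implicit Defensive.

Import GRing.Theory.

Local Open Scope ring_scope.

(* GRing.Algebra requires 1 != 0.  The following structure also contains the  *)
(* zero algebra.  It is built on Lmodule alone because Hierarchy-Builder does *)
(* not allow a join of Lmodule and PzRing that is not below GRing.Lalgebra;   *)
(* the ring structure is put on the sort by the instances that follow, so     *)
(* that 1 and * have their usual meaning.                                     *)
HB.mixin Record Lmodule_isPzAlgebra (K : fieldType) A of GRing.Lmodule K A := {
  pzalg_one : A;
  pzalg_mul : A -> A -> A;
  pzalg_mulA : associative pzalg_mul;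
  pzalg_1mul : left_id pzalg_one pzalg_mul;
  pzalg_mul1 : right_id pzalg_one pzalg_mul;
  pzalg_mulDl : left_distributive pzalg_mul +%R;
  pzalg_mulDr : right_distributive pzalg_mul +%R;
  pzalg_scaleAl : forall (k : K) (x y : A),
    k *: pzalg_mul x y = pzalg_mul (k *: x) y;
  pzalg_scaleAr : forall (k : K) (x y : A),
    k *: pzalg_mul x y = pzalg_mul x (k *: y)
}.

#[short(type="pzAlgType")]
HB.structure Definition PzAlgebra (K : fieldType) :=
  {A of GRing.Lmodule K A & Lmodule_isPzAlgebra K A}.

#[short(type="fdAlgType")]
HB.structure Definition FdAlgebra (K : fieldType) :=
  {A of PzAlgebra K A & Vector K A}.

HB.instance Definition _ (K : fieldType) (A : pzAlgType K) :=
  GRing.Zmodule_isPzRing.Build (PzAlgebra.sort A)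
    pzalg_mulA pzalg_1mul pzalg_mul1 pzalg_mulDl pzalg_mulDr.

HB.instance Definition _ (K : fieldType) (A : fdAlgType K) :=
  GRing.PzRing.copy (FdAlgebra.sort A) (PzAlgebra.sort A).

Section PzAlgebraTheory.
Variables (K : fieldType) (A : pzAlgType K).

Lemma pz_scalerAl (k : K) (x y : A) : k *: (x * y) = (k *: x) * y.
Proof. exact: pzalg_scaleAl. Qed.

Lemma pz_scalerAr (k : K) (x y : A) : k *: (x * y) = x * (k *: y).
Proof. exact: pzalg_scaleAr. Qed.

End PzAlgebraTheory.

Section PairAlgebra.
Variables (K : fieldType) (B C : pzAlgType K).

Fact pair_scaleAl (k : K) (x y : B * C) : k *: (x * y) = (k *: x) * y.
Proof. by congr pair; rewrite /= pz_scalerAl. Qed.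

Fact pair_scaleAr (k : K) (x y : B * C) : k *: (x * y) = x * (k *: y).
Proof. by congr pair; rewrite /= pz_scalerAr. Qed.

HB.instance Definition _ :=
  Lmodule_isPzAlgebra.Build K (B * C)%type
    (@mulrA (B * C)%type) (@mul1r (B * C)%type) (@mulr1 (B * C)%type)
    (@mulrDl (B * C)%type) (@mulrDr (B * C)%type) pair_scaleAl pair_scaleAr.

End PairAlgebra.

(* V (x) W is the free vector space on V * W modulo the span of the bilinearity *)
(* relations.                                                                   *)
Section Tensor.
Variables (K : fieldType) (V W : lmodType K).

Inductive tensor_rel : {freeg (V * W)%type / K} -> Prop :=
| tensor_rel0 : tensor_rel 0
| tensor_relD x y : tensor_rel x -> tensor_rel y -> tensor_rel (x + y)
| tensor_relZ k x : tensor_rel x -> tensor_rel (k *: x)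
| tensor_rel_addl v v' w :
    tensor_rel (<< (v + v', w) >> - << (v, w) >> - << (v', w) >>)
| tensor_rel_addr v w w' :
    tensor_rel (<< (v, w + w') >> - << (v, w) >> - << (v, w') >>)
| tensor_rel_scalel k v w :
    tensor_rel (<< (k *: v, w) >> - k *: << (v, w) >>)
| tensor_rel_scaler k v w :
    tensor_rel (<< (v, k *: w) >> - k *: << (v, w) >>).

Definition tensor_relb : {pred {freeg (V * W)%type / K}} :=
  fun x => `[< tensor_rel x >].

Fact tensor_relb_zmod_closed : zmod_closed tensor_relb.
Proof.
split=> [|x y]; rewrite !unfold_in; first exact/asboolP/tensor_rel0.
move=> /asboolP rx /asboolP ry; apply/asboolP/tensor_relD => //.
by rewrite -scaleN1r; apply: tensor_relZ.
Qed.

HB.instance Definition _ :=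
  GRing.isZmodClosed.Build _ tensor_relb tensor_relb_zmod_closed.

Definition tensor : Type := Quotient.quot tensor_relb.

HB.instance Definition _ := GRing.Zmodule.on tensor.

Local Notation pi := (\pi_(Quotient.quot tensor_relb))%qT.

Fact pi_tensor_eq (x y : {freeg (V * W)%type / K}) :
  tensor_rel (x - y) -> pi x = pi y.
Proof.
by move=> rxy; apply/eqP; rewrite -Quotient.idealrBE unfold_in; apply/asboolP.
Qed.

Fact tensor_rel_repr (x : {freeg (V * W)%type / K}) :
  tensor_rel (repr (pi x) - x).
Proof.
apply/asboolP; rewrite -[asbool _]/(_ \in tensor_relb) Quotient.idealrBE.
by rewrite reprK.
Qed.

Definition tensor_scale (k : K) (t : tensor) : tensor :=
  pi (k *: repr (t : Quotient.quot tensor_relb)).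

Fact tensor_scale_pi k x : tensor_scale k (pi x) = pi (k *: x).
Proof.
by apply: pi_tensor_eq; rewrite -scalerBr; apply/tensor_relZ/tensor_rel_repr.
Qed.

Fact piD x y : pi (x + y) = (pi x : tensor) + pi y.
Proof. exact: Quotient.pi_add. Qed.

Fact tensor_piP (P : tensor -> Prop) : (forall x, P (pi x)) -> forall t, P t.
Proof. by move=> Ppi t; rewrite -[t]reprK. Qed.

Fact tensor_scaleA k l t :
  tensor_scale k (tensor_scale l t) = tensor_scale (k * l) t.
Proof. by elim/tensor_piP: t => x; rewrite !tensor_scale_pi scalerA. Qed.

Fact tensor_scale1 : left_id 1 tensor_scale.
Proof. by elim/tensor_piP=> x; rewrite tensor_scale_pi scale1r. Qed.

Fact tensor_scaleDr : right_distributive tensor_scale +%R.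
Proof.
move=> k; elim/tensor_piP=> x; elim/tensor_piP=> y.
by rewrite -piD !tensor_scale_pi scalerDr piD.
Qed.

Fact tensor_scaleDl t : {morph tensor_scale^~ t : k l / k + l}.
Proof.
move=> k l; elim/tensor_piP: t => x.
by rewrite !tensor_scale_pi scalerDl piD.
Qed.

HB.instance Definition _ := GRing.Zmodule_isLmodule.Build K tensor
  tensor_scaleA tensor_scale1 tensor_scaleDr tensor_scaleDl.

Definition tens (v : V) (w : W) : tensor := pi << (v, w) >>.

Fact tens_bilinear : bilinear_for *:%R *:%R tens.
Proof.
have piB x y z : tensor_rel (x - y - z) -> pi x = (pi y : tensor) + pi z.
  by move=> r; rewrite -piD; apply: pi_tensor_eq; rewrite opprD addrA.
have piZ k x : pi (k *: x) = k *: (pi x : tensor).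
  by rewrite [RHS]tensor_scale_pi.
split=> [w k v v'|v k w w']; rewrite /tens.
  rewrite (piB _ _ _ (tensor_rel_addl _ _ _)); congr (_ + _).
  by apply: etrans (piZ _ _); apply/pi_tensor_eq/tensor_rel_scalel.
rewrite (piB _ _ _ (tensor_rel_addr _ _ _)); congr (_ + _).
by apply: etrans (piZ _ _); apply/pi_tensor_eq/tensor_rel_scaler.
Qed.

HB.instance Definition _ :=
  bilinear_isBilinear.Build K V W tensor *:%R *:%R tens tens_bilinear.

Lemma tens_ind (P : tensor -> Prop) :
    (forall v w, P (tens v w)) -> (forall s t, P s -> P t -> P (s + t)) ->
    (forall k t, P t -> P (k *: t)) ->
  forall t, P t.
Proof.
move=> Ptens PD PZ; have P0 : P 0.
  by rewrite -(scale0r (tens 0 0)); apply/PZ/Ptens.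
elim/tensor_piP=> x; rewrite -(freeg_sumE x).
elim: (dom x) => [|[v w] s IH]; first rewrite big_nil.
  suff -> : pi 0 = 0 :> tensor by [].
  by apply: (addrI (pi 0 : tensor)); rewrite -piD !addr0.
rewrite big_cons piD; apply: PD => //.
have -> : << coeff (v, w) x *g (v, w) >> = coeff (v, w) x *: << (v, w) >>.
  by apply/eqP/freeg_eqP=> z; rewrite coeffZ !coeffU mul1r.
by rewrite -tensor_scale_pi; apply/PZ/Ptens.
Qed.

End Tensor.

Arguments tensor {K} V%_type W%_type.
Arguments tens {K V W} v w.

Notation "v *t w" := (tens v w) (at level 40, left associativity) : ring_scope.

Lemma tensPl (K : fieldType) (V W : lmodType K) (w : W) (k : K) (v v' : V) :
  (k *: v + v') *t w = k *: (v *t w) + v' *t w.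
Proof. by rewrite linearDl linearZl_LR. Qed.

Lemma tensPr (K : fieldType) (V W : lmodType K) (v : V) (k : K) (w w' : W) :
  v *t (k *: w + w') = k *: (v *t w) + v *t w'.
Proof. by rewrite linearDr linearZr_LR. Qed.

Lemma tensor_linear_ext (K : fieldType) (V W X : lmodType K)
    (f g : {linear tensor V W -> X}) :
  (forall v w, f (v *t w) = g (v *t w)) -> f =1 g.
Proof.
move=> fg; elim/tens_ind=> [v w|s t fgs fgt|k t fgt]; first exact: fg.
  by rewrite !linearD fgs fgt.
by rewrite !linearZ fgt.
Qed.

Section TensorLift.
Variables (K : fieldType) (V W X : lmodType K).
Variable f : {bilinear V -> W -> X}.

Definition tensor_freelift : {freeg (V * W)%type / K} -> X := fglift (fun p => f p.1 p.2).

Fact tensor_freelift_linear : linear tensor_freelift.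
Proof.
have freefB := lift_is_additive (fun p : V * W => f p.1 p.2).
have freef0 : tensor_freelift 0 = 0 by rewrite -[0 in LHS](subrr 0) /tensor_freelift freefB subrr.
have freefN x : tensor_freelift (- x) = - tensor_freelift x.
  by rewrite -[in LHS](sub0r x) /tensor_freelift freefB -/tensor_freelift freef0 sub0r.
have freefD x y : tensor_freelift (x + y) = tensor_freelift x + tensor_freelift y.
  by rewrite -{1}[y]opprK /tensor_freelift freefB -/tensor_freelift freefN opprK.
move=> k x y; rewrite freefD; congr (_ + _).
rewrite -(freeg_sumE x); elim: (dom x) => [|p s IH].
  by rewrite big_nil scaler0 freef0 scaler0.
rewrite big_cons scalerDr !freefD scalerDr IH; congr (_ + _).
have -> : k *: << coeff p x *g p >> = << k * coeff p x *g p >>.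
  by apply/eqP/freeg_eqP=> z; rewrite coeffZ !coeffU mulrA.
by rewrite /tensor_freelift !liftU scalerA.
Qed.

HB.instance Definition _ :=
  GRing.isLinear.Build K _ X *:%R tensor_freelift tensor_freelift_linear.

Fact tensor_freelift_rel x : tensor_rel x -> tensor_freelift x = 0.
Proof.
have freefU v w : tensor_freelift << (v, w) >> = f v w by rewrite /tensor_freelift liftU scale1r.
elim=> [|y z _ ry _ rz|k y _ ry|v v' w|v w w'|k v w|k v w].
- by rewrite linear0.
- by rewrite linearD /= ry rz addr0.
- by rewrite linearZ /= ry scaler0.
- by rewrite !linearB /= !freefU linearDl /= addrAC addrK subrr.
- by rewrite !linearB /= !freefU linearD /= addrAC addrK subrr.
- by rewrite linearB linearZ /= !freefU linearZl_LR /= subrr.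
- by rewrite linearB linearZ /= !freefU linearZ /= subrr.
Qed.

Definition tensor_lift (t : tensor V W) : X :=
  tensor_freelift (repr (t : Quotient.quot (@tensor_relb K V W))).

Let lift_pi x : tensor_lift (\pi_(Quotient.quot (@tensor_relb K V W))%qT x) = tensor_freelift x.
Proof.
apply/eqP; rewrite -subr_eq0 /tensor_lift -linearB; apply/eqP.
exact/tensor_freelift_rel/tensor_rel_repr.
Qed.

Fact tensor_lift_linear : linear tensor_lift.
Proof.
move=> k; elim/tensor_piP=> x; elim/tensor_piP=> y.
have -> : k *: (\pi_(Quotient.quot (@tensor_relb K V W))%qT x : tensor V W) =
          \pi_(Quotient.quot (@tensor_relb K V W))%qT (k *: x).
  exact: tensor_scale_pi.
by rewrite -piD !lift_pi linearP.
Qed.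

HB.instance Definition _ :=
  GRing.isLinear.Build K (tensor V W) X *:%R tensor_lift tensor_lift_linear.

Lemma tensor_liftE v w : tensor_lift (v *t w) = f v w.
Proof. by rewrite lift_pi /tensor_freelift liftU scale1r. Qed.

End TensorLift.

Section TensorMap.
Variables (K : fieldType) (V V' W W' : lmodType K).
Variables (f : {linear V -> V'}) (g : {linear W -> W'}).

Definition tmap_fun (v : V) (w : W) : tensor V' W' := f v *t g w.

Fact tmap_fun_bilinear : bilinear_for *:%R *:%R tmap_fun.
Proof.
by split=> [w k v v'|v k w w']; rewrite /tmap_fun linearP (tensPl, tensPr).
Qed.

HB.instance Definition _ :=
  bilinear_isBilinear.Build K V W (tensor V' W') *:%R *:%R
    tmap_fun tmap_fun_bilinear.

Definition tmap : tensor V W -> tensor V' W' :=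
  tensor_lift tmap_fun.

HB.instance Definition _ :=
  GRing.isLinear.Build K (tensor V W) (tensor V' W') *:%R
    tmap (tensor_lift_linear tmap_fun).

Lemma tmapE v w : tmap (v *t w) = f v *t g w.
Proof. exact: tensor_liftE. Qed.

End TensorMap.

Section TensorAssociator.
Variables (K : fieldType) (U V W : lmodType K).

Definition tassoc_slice (w : W) (u : U) (v : V) : tensor U (tensor V W) :=
  u *t (v *t w).

Fact tassoc_slice_bilinear w : bilinear_for *:%R *:%R (tassoc_slice w).
Proof.
split=> [v k u u'|u k v v']; first exact: tensPl.
by rewrite /tassoc_slice tensPl tensPr.
Qed.

HB.instance Definition _ w :=
  bilinear_isBilinear.Build K U V _ *:%R *:%R
    (tassoc_slice w) (tassoc_slice_bilinear w).

Definition tassoc_fun (t : tensor U V) (w : W) : tensor U (tensor V W) :=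
  tensor_lift (tassoc_slice w) t.

Fact tassoc_fun_bilinear : bilinear_for *:%R *:%R tassoc_fun.
Proof.
split=> [w k s t|t k w w']; first exact: linearP.
have tD x s1 s2 : tassoc_fun (s1 + s2) x = tassoc_fun s1 x + tassoc_fun s2 x.
  exact: linearD.
have tZ x l s1 : tassoc_fun (l *: s1) x = l *: tassoc_fun s1 x.
  exact: linearZ.
elim/tens_ind: t => [u v|s t IHs IHt|l t IH].
- by rewrite /tassoc_fun !tensor_liftE /= /tassoc_slice !tensPr.
- by rewrite !tD IHs IHt /= scalerDr addrACA.
by rewrite !tZ IH /= scalerDr !scalerA mulrC.
Qed.

HB.instance Definition _ :=
  bilinear_isBilinear.Build K (tensor U V) W _ *:%R *:%R
    tassoc_fun tassoc_fun_bilinear.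

Definition tassoc : tensor (tensor U V) W -> tensor U (tensor V W) :=
  tensor_lift tassoc_fun.

HB.instance Definition _ :=
  GRing.isLinear.Build K (tensor (tensor U V) W) (tensor U (tensor V W)) *:%R
    tassoc (tensor_lift_linear tassoc_fun).

Lemma tassocE u v w : tassoc ((u *t v) *t w) = u *t (v *t w).
Proof. by rewrite /tassoc /= tensor_liftE /= /tassoc_fun tensor_liftE. Qed.

Definition tassocV_slice (u : U) (v : V) (w : W) : tensor (tensor U V) W :=
  (u *t v) *t w.

Fact tassocV_slice_bilinear u : bilinear_for *:%R *:%R (tassocV_slice u).
Proof.
split=> [w k v v'|v k w w']; last exact: tensPr.
by rewrite /tassocV_slice tensPr tensPl.
Qed.

HB.instance Definition _ u :=
  bilinear_isBilinear.Build K V W _ *:%R *:%R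
    (tassocV_slice u) (tassocV_slice_bilinear u).

Definition tassocV_fun (u : U) (t : tensor V W) : tensor (tensor U V) W :=
  tensor_lift (tassocV_slice u) t.

Fact tassocV_fun_bilinear : bilinear_for *:%R *:%R tassocV_fun.
Proof.
split=> [t k u u'|u k s t]; last exact: linearP.
have tD x s1 s2 : tassocV_fun x (s1 + s2) = tassocV_fun x s1 + tassocV_fun x s2.
  exact: linearD.
have tZ x l s1 : tassocV_fun x (l *: s1) = l *: tassocV_fun x s1.
  exact: linearZ.
elim/tens_ind: t => [v w|s t IHs IHt|l t IH].
- by rewrite /tassocV_fun !tensor_liftE /= /tassocV_slice !tensPl.
- by rewrite !tD IHs IHt /= scalerDr addrACA.
by rewrite !tZ IH /= scalerDr !scalerA mulrC.
Qed.

HB.instance Definition _ :=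
  bilinear_isBilinear.Build K U (tensor V W) _ *:%R *:%R
    tassocV_fun tassocV_fun_bilinear.

Definition tassocV : tensor U (tensor V W) -> tensor (tensor U V) W :=
  tensor_lift tassocV_fun.

HB.instance Definition _ :=
  GRing.isLinear.Build K (tensor U (tensor V W)) (tensor (tensor U V) W) *:%R
    tassocV (tensor_lift_linear tassocV_fun).

Lemma tassocVE u v w : tassocV (u *t (v *t w)) = (u *t v) *t w.
Proof. by rewrite /tassocV /= tensor_liftE /= /tassocV_fun tensor_liftE. Qed.

Lemma tassocK : cancel tassoc tassocV.
Proof.
elim/tens_ind=> [t w|s t IHs IHt|k t IH].
- elim/tens_ind: t => [u v|s t IHs IHt|k t IH].
  + by rewrite tassocE tassocVE.
  + by rewrite linearDl /= !linearD /= IHs IHt.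
  by rewrite linearZl_LR /= !linearZ /= IH.
- by rewrite !linearD /= IHs IHt.
by rewrite !linearZ /= IH.
Qed.

Lemma tassocVK : cancel tassocV tassoc.
Proof.
elim/tens_ind=> [u t|s t IHs IHt|k t IH].
- elim/tens_ind: t => [v w|s t IHs IHt|k t IH].
  + by rewrite tassocVE tassocE.
  + by rewrite linearDr /= !linearD /= IHs IHt.
  by rewrite linearZr_LR /= !linearZ /= IH.
- by rewrite !linearD /= IHs IHt.
by rewrite !linearZ /= IH.
Qed.

End TensorAssociator.

Arguments tassoc {K U V W}.
Arguments tassocV {K U V W}.

Section Multiplication.
Variables (K : fieldType) (A : pzAlgType K).

Definition pzmul (x y : A) : A := x * y.

Fact pzmul_bilinear : bilinear_for *:%R *:%R pzmul.
Proof.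
split=> [y k x x'|x k y y']; rewrite /pzmul.
  by rewrite mulrDl -pz_scalerAl.
by rewrite mulrDr -pz_scalerAr.
Qed.

HB.instance Definition _ :=
  bilinear_isBilinear.Build K A A A *:%R *:%R pzmul pzmul_bilinear.

Definition mu : tensor A A -> A :=
  tensor_lift pzmul.

HB.instance Definition _ :=
  GRing.isLinear.Build K (tensor A A) A *:%R
    mu (tensor_lift_linear pzmul).

Lemma muE x y : mu (x *t y) = x * y.
Proof. exact: tensor_liftE. Qed.

End Multiplication.

Arguments mu {K} A.

Section TwistingMap.
Variables (K : fieldType) (A B : pzAlgType K).

Local Notation idA := (idfun : {linear A -> A}).
Local Notation idB := (idfun : {linear B -> B}).

(* The associators make explicit the identification of the two iterated       *)
(* tensor products of three spaces.                                           *)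
Definition twisting_map (chi : {linear tensor A B -> tensor B A}) : Prop :=
  [/\ forall b : B, chi ((1 : A) *t b) = b *t (1 : A),
      forall a : A, chi (a *t (1 : B)) = (1 : B) *t a,
      chi \o tmap (mu A) idB =1
        tmap idB (mu A) \o tassoc \o tmap chi idA \o tassocV
          \o tmap idA chi \o tassoc
    & chi \o tmap idA (mu B) =1
        tmap (mu B) idA \o tassocV \o tmap idB chi \o tassoc
          \o tmap chi idB \o tassocV].

End TwistingMap.

Arguments twisting_map {K} A%_type B%_type chi.

Section DirectProduct.
Variables (K : fieldType) (B C : lmodType K).

Definition inB (b : B) : B * C := (b, 0).
Definition inC (c : C) : B * C := (0, c).

Fact inB_linear : linear inB.
Proof. by move=> k b b'; congr pair; rewrite /= scaler0 addr0. Qed.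

Fact inC_linear : linear inC.
Proof. by move=> k c c'; congr pair; rewrite /= scaler0 addr0. Qed.

HB.instance Definition _ :=
  GRing.isLinear.Build K B (B * C)%type *:%R inB inB_linear.
HB.instance Definition _ :=
  GRing.isLinear.Build K C (B * C)%type *:%R inC inC_linear.

Section DirectSum.
Variable A : lmodType K.
Variables (Theta : {linear tensor A B -> tensor B A}).
Variables (Upsilon : {linear tensor A C -> tensor C A}).

Local Notation idA := (idfun : {linear A -> A}).

Definition oplus_fun (a : A) (d : B * C) : tensor (B * C) A :=
  tmap inB idA (Theta (a *t d.1)) + tmap inC idA (Upsilon (a *t d.2)).

Fact oplus_fun_bilinear : bilinear_for *:%R *:%R oplus_fun.
Proof.
have TP := linearP (tmap inB idA \o Theta).
have UP := linearP (tmap inC idA \o Upsilon).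
split=> [d k a a'|a k d d']; rewrite /oplus_fun.
  by rewrite !tensPl [tmap _ _ _]TP [X in _ + X]UP /= scalerDr addrACA.
by rewrite [(_ + _).1]/= [(_ + _).2]/= !tensPr [tmap _ _ _]TP [X in _ + X]UP
  /= scalerDr addrACA.
Qed.

HB.instance Definition _ :=
  bilinear_isBilinear.Build K A (B * C)%type _ *:%R *:%R
    oplus_fun oplus_fun_bilinear.

Definition oplus : tensor A (B * C) -> tensor (B * C) A :=
  tensor_lift oplus_fun.

HB.instance Definition _ :=
  GRing.isLinear.Build K (tensor A (B * C)) (tensor (B * C) A) *:%R
    oplus (tensor_lift_linear oplus_fun).

Lemma oplusE a b c : oplus (a *t (b, c)) =
  tmap inB idA (Theta (a *t b)) + tmap inC idA (Upsilon (a *t c)).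
Proof. exact: tensor_liftE. Qed.

End DirectSum.
End DirectProduct.

Arguments inB {K B C}.
Arguments inC {K B C}.

(* Main.v *)
Require Import Defs.
From mathcomp Require Import all_boot all_algebra.

Set Implicit Arguments.
Unset Strict Implicit.
Unset Printing Implicit Defensive.

Import GRing.Theory.

Local Open Scope ring_scope.

(** Let [eB = (1, 0)] and [eC = (0, 1)] be the two idempotents of [D = B * C].

    Suppose that [psi] is a twisting map.  Then [psi (a *t 1) = 1 *t a], whose
    [C]-component [1 *t a] is the sum of the [C]-components of [psi (a *t eB)]
    and [psi (a *t eC)].  The latter is [Upsilon (a *t 1) = 1 *t a], so the
    former vanishes; since the [B]-component of [psi (a *t eB)] is
    [Theta (a *t 1) = 1 *t a], this gives [psi (a *t eB) = eB *t a]
    ([twisting_idempotents]).  Compatibility of [psi] with the product of [D]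
    then makes [psi] commute with left multiplication by [eB]
    ([twisting_mull]).  As [eB * (b, 0) = (b, 0)], the tensor
    [psi (a *t (b, 0))] is fixed by [eB], so it has no [C]-component and equals
    the image of [Theta (a *t b)].  The same holds for [eC], and together these
    say that [psi] is the direct sum of [Theta] and [Upsilon].

    Conversely, being the direct sum means that [psi] restricts to [Theta]
    along [inB] and to [Upsilon] along [inC] ([oplus_restricts]).  Both sides of
    each multiplicativity axiom are natural with respect to such restrictions
    ([hexA_natural], [hexB_natural]).  As [D] is spanned by the images of [inB]
    and [inC], the axioms for [psi] reduce to those for [Theta] and [Upsilon],
    except for the mixed products [(b, 0) * (0, c)] and [(0, c) * (b, 0)],
    where both sides vanish. *)

(** * Naturality of the tensor product *)

Section Naturality.
Variable K : fieldType.

(** Every naturality argument below is a chain of such squares. *)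
Lemma tmap_square (V V1 V2 V' W W1 W2 W' : lmodType K)
    (f : {linear V1 -> V'}) (f' : {linear V -> V1})
    (h : {linear V2 -> V'}) (h' : {linear V -> V2})
    (g : {linear W1 -> W'}) (g' : {linear W -> W1})
    (k : {linear W2 -> W'}) (k' : {linear W -> W2}) :
  f \o f' =1 h \o h' -> g \o g' =1 k \o k' ->
  tmap f g \o tmap f' g' =1 tmap h k \o tmap h' k'.
Proof.
move=> fh gk; apply: tensor_linear_ext => v w /=.
by rewrite !tmapE; congr (_ *t _); [apply: fh | apply: gk].
Qed.

Lemma tmap_id (V W : lmodType K) :
  tmap (idfun : {linear V -> V}) (idfun : {linear W -> W}) =1 idfun.
Proof.
apply: (@tensor_linear_ext _ _ _ _ (tmap idfun idfun) idfun) => v w.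
by rewrite /= tmapE.
Qed.

Lemma tmap_tmap_id (U V W W' : lmodType K) (g : {linear W -> W'}) :
  tmap (tmap (idfun : {linear U -> U}) (idfun : {linear V -> V})) g
    =1 tmap (idfun : {linear tensor U V -> tensor U V}) g.
Proof.
apply: (@tensor_linear_ext _ _ _ _ (tmap (tmap idfun idfun) g) (tmap idfun g)).
by move=> t w; rewrite /= !tmapE /= tmap_id.
Qed.

Lemma tmap_nulll (V V' W W' : lmodType K) (g : {linear W -> W'}) :
  tmap (\0 : {linear V -> V'}) g =1 \0.
Proof.
apply: (@tensor_linear_ext _ _ _ _ (tmap \0 g) \0) => v w.
by rewrite /= tmapE linear0l.
Qed.

Lemma tmap_nullr (V V' W W' : lmodType K) (f : {linear V -> V'}) :
  tmap f (\0 : {linear W -> W'}) =1 \0.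
Proof.
apply: (@tensor_linear_ext _ _ _ _ (tmap f \0) \0) => v w.
by rewrite /= tmapE linear0r.
Qed.

Lemma tensor3_ext (U V W X : lmodType K)
    (f g : {linear tensor (tensor U V) W -> X}) :
  (forall u v w, f ((u *t v) *t w) = g ((u *t v) *t w)) -> f =1 g.
Proof.
move=> fg; apply: tensor_linear_ext => t w.
elim/tens_ind: t => [u v|s t fgs fgt|k t fgt]; first exact: fg.
  by rewrite linearDl (linearD f) (linearD g) fgs fgt.
by rewrite linearZl_LR (linearZ_LR f) (linearZ_LR g) fgt.
Qed.

Lemma tensor_ext_slice (U V W X : lmodType K)
    (f : {linear tensor U (tensor V W) -> X}) (g : {linear tensor V W -> X}) u :
  (forall v w, f (u *t (v *t w)) = g (v *t w)) ->
  forall t, f (u *t t) = g t.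
Proof.
move=> fg; elim/tens_ind=> [v w|s t fgs fgt|k t fgt]; first exact: fg.
  by rewrite linearDr (linearD f) (linearD g) fgs fgt.
by rewrite linearZr_LR (linearZ_LR f) (linearZ_LR g) fgt.
Qed.

Section Associator.
Variables (U U' V V' W W' : lmodType K).
Variables (f : {linear U -> U'}) (g : {linear V -> V'}) (h : {linear W -> W'}).

Lemma tassoc_natural :
  tassoc \o tmap (tmap f g) h =1 tmap f (tmap g h) \o tassoc.
Proof.
apply: tensor3_ext => u v w.
by rewrite /= !(tassocE, tmapE) /= !(tassocE, tmapE).
Qed.

Lemma tassocV_natural :
  tassocV \o tmap f (tmap g h) =1 tmap (tmap f g) h \o tassocV.
Proof.
move=> t; have e := tassoc_natural (tassocV t).
transitivity (tassocV (tassoc (tmap (tmap f g) h (tassocV t)))).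
  congr tassocV; rewrite -[t in LHS](tassocVK t); exact: esym e.
exact: tassocK.
Qed.

End Associator.
End Naturality.

(** * Restricting a map along a linear map into the second factor *)

Section Restriction.
Variables (K : fieldType) (A V D : lmodType K).

(** For an inclusion [j] this says that [psi] carries [A (x) V] into
    [V (x) A] and acts there as [chi]. *)
Definition restricts (j : {linear V -> D})
    (psi : {linear tensor A D -> tensor D A})
    (chi : {linear tensor A V -> tensor V A}) : Prop :=
  psi \o tmap (idfun : {linear A -> A}) j
    =1 tmap j (idfun : {linear A -> A}) \o chi.

Lemma restrictsE j psi chi : restricts j psi chi ->
  forall a v, psi (a *t j v) = tmap j (idfun : {linear A -> A}) (chi (a *t v)).
Proof. by move=> jP a v; have /= := jP (a *t v); rewrite tmapE. Qed.

End Restriction.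

(** * The multiplicativity axioms under restriction *)

Section Hexagons.
Variable K : fieldType.

(** The right-hand side of the twisting axiom for [mu A]. *)
Definition hexA (A : pzAlgType K) (V : lmodType K)
    (chi : {linear tensor A V -> tensor V A}) :
    {linear tensor (tensor A A) V -> tensor V A} :=
  tmap idfun (mu A) \o tassoc \o tmap chi idfun \o tassocV
    \o tmap idfun chi \o tassoc.

(** The right-hand side of the twisting axiom for [mu B], with the two
    occurrences of the twisting map and the product made independent, so that
    it also covers a product of an element of [B] with one of [C]. *)
Definition hexB (A V W X : lmodType K) (m : {linear tensor V W -> X})
    (chi : {linear tensor A V -> tensor V A})
    (chi' : {linear tensor A W -> tensor W A}) :
    {linear tensor A (tensor V W) -> tensor X A} :=
  tmap m idfun \o tassocV \o tmap idfun chi' \o tassoc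
    \o tmap chi idfun \o tassocV.

(** Each factor of [hexA] commutes with the map induced by [j]: the associators
    by naturality, [chi] by restriction, and [mu A] because [j] acts on the
    other tensor factor. *)
Lemma hexA_natural (A : pzAlgType K) (V D : lmodType K)
    (j : {linear V -> D}) psi chi : restricts j psi chi ->
  hexA psi \o tmap (idfun : {linear tensor A A -> tensor A A}) j
    =1 tmap j (idfun : {linear A -> A}) \o hexA chi.
Proof.
move=> jP t; rewrite /hexA /=.
rewrite -tmap_tmap_id.
rewrite [tassoc (tmap (tmap _ _) _ _)]tassoc_natural /=.
rewrite [tmap idfun psi _](tmap_square (h := idfun) (h' := idfun) _ jP) //=.
rewrite [tassocV (tmap _ (tmap _ _) _)]tassocV_natural /=.
rewrite [tmap psi _ _](tmap_square (k := idfun) (k' := idfun) jP) //=.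
rewrite [tassoc (tmap (tmap _ _) _ _)]tassoc_natural /=.
apply: tmap_square => // u; exact: congr1 (tmap_id u).
Qed.

(** As for [hexA], except that the product now acts on the factors moved by [j]
    and [k], which is why it has to be compatible with them. *)
Lemma hexB_natural (A V W D D' X Y : lmodType K)
    (j : {linear V -> D}) (k : {linear W -> D'}) (l : {linear Y -> X})
    (m : {linear tensor D D' -> X}) (m' : {linear tensor V W -> Y})
    (psi : {linear tensor A D -> tensor D A})
    (psi' : {linear tensor A D' -> tensor D' A}) chi chi' :
  restricts j psi chi -> restricts k psi' chi' -> m \o tmap j k =1 l \o m' ->
  hexB m psi psi' \o tmap (idfun : {linear A -> A}) (tmap j k)
    =1 tmap l (idfun : {linear A -> A}) \o hexB m' chi chi'.
Proof.
move=> jP kP mP t; rewrite /hexB /=.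
rewrite [tassocV (tmap _ (tmap _ _) _)]tassocV_natural /=.
rewrite [tmap psi _ _](tmap_square (k := k) (k' := idfun) jP) //=.
rewrite [tassoc (tmap (tmap _ _) _ _)]tassoc_natural /=.
rewrite [tmap _ psi' _](tmap_square (h := j) (h' := idfun) _ kP) //=.
rewrite [tassocV (tmap _ (tmap _ _) _)]tassocV_natural /=.
exact: tmap_square.
Qed.

(** The axiom for [chi] gives the one for [psi] on the image of [j]. *)
Lemma hexA_restricts (A : pzAlgType K) (V D : lmodType K)
    (j : {linear V -> D}) psi chi :
  restricts j psi chi ->
  chi \o tmap (mu A) (idfun : {linear V -> V}) =1 hexA chi ->
  (psi \o tmap (mu A) (idfun : {linear D -> D})) \o tmap idfun j
    =1 hexA psi \o tmap idfun j.
Proof.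
move=> jP chiP t; apply: etrans (esym (hexA_natural jP t)).
apply: etrans (congr1 (tmap j idfun) (chiP t)).
apply: etrans (jP (tmap (mu A) idfun t)); congr (psi _).
exact: (tmap_square (h := idfun) (h' := mu A) (k := j) (k' := idfun)).
Qed.

(** The axiom for [psi] on the images of [j] and [k], whose products lie in the
    image of [l].  For equal [j], [k], [l] the hypothesis on [chiY] is the axiom
    for [chi]. *)
Lemma hexB_restricts (A V W D Y : lmodType K)
    (j : {linear V -> D}) (k : {linear W -> D}) (l : {linear Y -> D})
    (m : {linear tensor D D -> D}) (m' : {linear tensor V W -> Y})
    (psi : {linear tensor A D -> tensor D A}) chi chi' chiY :
  restricts j psi chi -> restricts k psi chi' -> restricts l psi chiY ->
  m \o tmap j k =1 l \o m' ->
  chiY \o tmap (idfun : {linear A -> A}) m' =1 hexB m' chi chi' ->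
  (psi \o tmap (idfun : {linear A -> A}) m) \o tmap idfun (tmap j k)
    =1 hexB m psi psi \o tmap idfun (tmap j k).
Proof.
move=> jP kP lP mP chiP t; apply: etrans (esym (hexB_natural jP kP mP t)).
apply: etrans (congr1 (tmap l idfun) (chiP t)).
apply: etrans (lP (tmap idfun m' t)); congr (psi _).
exact: (tmap_square (h := idfun) (h' := idfun) _ mP).
Qed.

(** This feeds [hexB_restricts] for two subspaces whose products are all
    zero. *)
Lemma hexB_null (A V W Y : lmodType K) chi chi'
    (chiY : {linear tensor A Y -> tensor Y A}) :
  chiY \o tmap (idfun : {linear A -> A}) (\0 : {linear tensor V W -> Y})
    =1 hexB \0 chi chi'.
Proof. by move=> t; rewrite /hexB /= tmap_nulll tmap_nullr [LHS]linear0. Qed.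

End Hexagons.

(** * Maps on tensors with a direct product *)

Section PairTensor.
Variables (K : fieldType) (B C : lmodType K).

Local Notation D := (B * C)%type.

Lemma inB_inC (d : D) : inB d.1 + inC d.2 = d.
Proof. by case: d => b c; congr pair; rewrite /= ?addr0 ?add0r. Qed.

Lemma tmap_inB_inC (A : lmodType K) (t : tensor D A) :
  tmap inB (idfun : {linear A -> A}) (tmap fst (idfun : {linear A -> A}) t)
  + tmap inC (idfun : {linear A -> A}) (tmap snd (idfun : {linear A -> A}) t)
  = t.
Proof.
have := @tensor_linear_ext _ _ _ _
  ((tmap inB idfun \o tmap fst idfun) \+ (tmap inC idfun \o tmap snd idfun))
  (idfun : {linear tensor D A -> tensor D A}).
by apply=> d a; rewrite /= !tmapE -linearDl /= inB_inC.
Qed.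

Lemma pair_tensor_ext (V X : lmodType K) (f g : {linear tensor V D -> X}) :
  f \o tmap (idfun : {linear V -> V}) inB
    =1 g \o tmap (idfun : {linear V -> V}) inB ->
  f \o tmap (idfun : {linear V -> V}) inC
    =1 g \o tmap (idfun : {linear V -> V}) inC ->
  f =1 g.
Proof.
move=> fgB fgC; apply: tensor_linear_ext => v d.
have := fgC (v *t d.2); have := fgB (v *t d.1); rewrite /= !tmapE /= => eB eC.
by rewrite -[d]inB_inC linearDr (linearD f) (linearD g) eB eC.
Qed.

Lemma pair_tensor2_ext (V X : lmodType K)
    (f g : {linear tensor V (tensor D D) -> X}) :
  let id := (idfun : {linear V -> V}) in
  f \o tmap id (tmap inB inB) =1 g \o tmap id (tmap inB inB) ->
  f \o tmap id (tmap inB inC) =1 g \o tmap id (tmap inB inC) ->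
  f \o tmap id (tmap inC inB) =1 g \o tmap id (tmap inC inB) ->
  f \o tmap id (tmap inC inC) =1 g \o tmap id (tmap inC inC) ->
  f =1 g.
Proof.
move=> id eBB eBC eCB eCC t; rewrite -(tassocVK t).
apply: (@tensor3_ext _ _ _ _ _ (f \o tassoc) (g \o tassoc)) => v d d' /=.
rewrite !tassocE -[d]inB_inC -[d']inB_inC.
rewrite linearDl /= !linearDr /= !(linearD f) !(linearD g).
have := eBB (v *t (d.1 *t d'.1)); have := eBC (v *t (d.1 *t d'.2)).
have := eCB (v *t (d.2 *t d'.1)); have := eCC (v *t (d.2 *t d'.2)).
by rewrite /= !tmapE /= !tmapE => -> -> -> ->.
Qed.

End PairTensor.

(** * Direct sums of twisting maps are twisting maps *)

(** The left-hand unit is that of [B * C] as an algebra over [K], the form in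
    which it occurs in the twisting axioms. *)
Lemma inB1_inC1 (K : fieldType) (B C : pzAlgType K) :
  GRing.one ((B * C)%type : pzAlgType K) = @inB K B C 1 + @inC K B C 1.
Proof. by congr pair; rewrite /= ?addr0 ?add0r. Qed.

Section SumToTwisting.
Variables (K : fieldType) (A B C : pzAlgType K).

Local Notation D := (B * C)%type.

Lemma oplus_restricts (psi : {linear tensor A D -> tensor D A})
    (chi : {linear tensor A B -> tensor B A})
    (chi' : {linear tensor A C -> tensor C A}) :
  psi =1 oplus chi chi' <-> restricts inB psi chi /\ restricts inC psi chi'.
Proof.
have oB : restricts inB (oplus chi chi') chi.
  apply: tensor_linear_ext => a b /=.
  by rewrite tmapE oplusE linear0r !linear0 addr0.
have oC : restricts inC (oplus chi chi') chi'.
  apply: tensor_linear_ext => a c /=.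
  by rewrite tmapE oplusE linear0r !linear0 add0r.
split=> [e | [pB pC]].
  by split=> t; rewrite /= e; [apply: oB | apply: oC].
by apply: pair_tensor_ext => t; rewrite ?[LHS]pB ?[LHS]pC ?[RHS]oB ?[RHS]oC.
Qed.

Lemma twisting_of_restricts (psi : {linear tensor A D -> tensor D A})
    (chi : {linear tensor A B -> tensor B A})
    (chi' : {linear tensor A C -> tensor C A}) :
  twisting_map A B chi -> twisting_map A C chi' ->
  restricts inB psi chi -> restricts inC psi chi' -> twisting_map A D psi.
Proof.
move=> [B1 B2 B3 B4] [C1 C2 C3 C4] pB pC.
have muBB : mu D \o tmap inB inB =1 inB \o mu B.
  apply: tensor_linear_ext => b b' /=.
  by rewrite tmapE !muE; congr pair; rewrite /= mul0r.
have muCC : mu D \o tmap inC inC =1 inC \o mu C.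
  apply: tensor_linear_ext => c c' /=.
  by rewrite tmapE !muE; congr pair; rewrite /= mul0r.
have muBC : mu D \o tmap inB inC =1 inB \o \0.
  apply: tensor_linear_ext => b c /=.
  by rewrite tmapE !muE; congr pair; rewrite /= ?mul0r ?mulr0.
have muCB : mu D \o tmap inC inB =1 inB \o \0.
  apply: tensor_linear_ext => c b /=.
  by rewrite tmapE !muE; congr pair; rewrite /= ?mul0r ?mulr0.
have pBE := restrictsE pB; have pCE := restrictsE pC.
split.
- move=> d; rewrite -[d]inB_inC linearDr linearD /= pBE pCE B1 C1 !tmapE /=.
  by rewrite linearDl.
- move=> a; rewrite inB1_inC1 linearDr linearD /= pBE pCE B2 C2.
  by rewrite !tmapE /= -linearDl.
- (* [hexA psi] repackages the right-hand side as a bundled linear map. *)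
  suff G : psi \o tmap (mu A) (idfun : {linear D -> D}) =1 hexA psi by exact: G.
  apply: (@pair_tensor_ext _ _ _ _ _ (psi \o tmap (mu A) idfun) (hexA psi)).
    exact: hexA_restricts pB B3.
  exact: hexA_restricts pC C3.
suff G : psi \o tmap (idfun : {linear A -> A}) (mu D) =1 hexB (mu D) psi psi.
  exact: G.
apply: (@pair_tensor2_ext _ _ _ _ _ (psi \o tmap idfun (mu D))
  (hexB (mu D) psi psi)).
- exact: (hexB_restricts pB pB pB muBB B4).
- exact: (hexB_restricts pB pC pB muBC (hexB_null _ _ _)).
- exact: (hexB_restricts pC pB pB muCB (hexB_null _ _ _)).
- exact: (hexB_restricts pC pC pC muCC C4).
Qed.

End SumToTwisting.

(** * Twisting maps with twisting diagonal parts are direct sums *)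

Section TwistingToSum.
Variables (K : fieldType) (A : pzAlgType K).

(** In the product axiom at [a *t (e *t d)], the inner use of [psi] only moves
    [a] past [e], so what remains is [psi (a *t d)] multiplied by [e] on the
    left.  That multiplication is given as a linear map [p], since for the
    idempotents below it is a projection followed by an inclusion. *)
Lemma twisting_mull (D : pzAlgType K) (psi : {linear tensor A D -> tensor D A})
    (e : D) (p : {linear D -> D}) :
  twisting_map A D psi -> (forall d, e * d = p d) ->
  (forall a, psi (a *t e) = e *t a) ->
  forall a d, psi (a *t p d) = tmap p (idfun : {linear A -> A}) (psi (a *t d)).
Proof.
move=> [_ _ _ P] pE eP a d.
have := P (a *t (e *t d)).
rewrite /= tmapE /= muE tassocVE tmapE /= eP tassocE tmapE /= pE => ->.
apply: (@tensor_ext_slice _ _ _ _ _ (tmap (mu D) idfun \o tassocV)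
  (tmap p idfun)) => d' a'.
by rewrite /= tassocVE !tmapE /= muE pE.
Qed.

Variables B C : pzAlgType K.
Local Notation D := (B * C)%type.
Local Notation eB := (@inB K B C 1).
Local Notation eC := (@inC K B C 1).
Local Notation idA := (idfun : {linear A -> A}).

(** The unit axiom splits as a sum over the two idempotents.  The hypothesis on
    [eC] accounts for the whole [C]-component, so [psi (a *t eB)] has none; the
    case of [eC] then follows by subtraction. *)
Lemma twisting_idempotents (psi : {linear tensor A D -> tensor D A}) :
  twisting_map A D psi ->
  (forall a, tmap fst idA (psi (a *t eB)) = (1 : B) *t a) ->
  (forall a, tmap snd idA (psi (a *t eC)) = (1 : C) *t a) ->
  (forall a, psi (a *t eB) = eB *t a) /\
  (forall a, psi (a *t eC) = eC *t a).
Proof.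
move=> [_ P1 _ _] pB pC.
have P1E a : psi (a *t eB) + psi (a *t eC) = eB *t a + eC *t a.
  by rewrite -(linearD psi) -linearDr -inB1_inC1 P1 -linearDl -inB1_inC1.
have additive_cancel (f : {linear tensor D A -> tensor C A}) s t u v :
    s + t = u + v -> f t = f v -> f s = f u.
  by move=> e ftv; apply: (addIr (f t)); rewrite -linearD e linearD ftv.
have pB' a : psi (a *t eB) = eB *t a.
  have sB : tmap snd idA (psi (a *t eB)) = 0.
    apply: etrans (additive_cancel (tmap snd idA) _ _ _ _ (P1E a) _) _.
      by apply: etrans (pC a) _; rewrite /= tmapE.
    by rewrite /= tmapE linear0l.
  by rewrite -[LHS]tmap_inB_inC pB sB linear0 addr0 tmapE.
by split=> // a; apply: (addrI (psi (a *t eB))); rewrite P1E pB'.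
Qed.

(** [(b, 0)] is its own product with [eB], so its image under [psi] lies in the
    part of [tensor D A] that [eB] projects onto. *)
Lemma restricts_of_twisting (psi : {linear tensor A D -> tensor D A})
    (chi : {linear tensor A B -> tensor B A} :=
       tmap fst idfun \o psi \o tmap idfun inB)
    (chi' : {linear tensor A C -> tensor C A} :=
       tmap snd idfun \o psi \o tmap idfun inC) :
  twisting_map A D psi -> twisting_map A B chi -> twisting_map A C chi' ->
  restricts inB psi chi /\ restricts inC psi chi'.
Proof.
move=> P [_ B1 _ _] [_ C1 _ _].
have [||pB' pC'] := twisting_idempotents P.
- by move=> a; have := B1 a; rewrite /= tmapE.
- by move=> a; have := C1 a; rewrite /= tmapE.
have mulB d : eB * d = (inB \o fst) d.
  by case: d => b c; congr pair; rewrite /= ?mul1r ?mul0r.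
have mulC d : eC * d = (inC \o snd) d.
  by case: d => b c; congr pair; rewrite /= ?mul1r ?mul0r.
split; apply: tensor_linear_ext => a x; rewrite /= tmapE /=.
  apply: etrans (twisting_mull P mulB pB' a (inB x)) _.
  apply: etrans (congr1 _ (esym (tmap_id _))) _; exact: tmap_square.
apply: etrans (twisting_mull P mulC pC' a (inC x)) _.
apply: etrans (congr1 _ (esym (tmap_id _))) _; exact: tmap_square.
Qed.

End TwistingToSum.

Theorem corollary3p7 (K : fieldType) (A : pzAlgType K) (B C : fdAlgType K)
    (psi : {linear tensor A (B * C) -> tensor (B * C) A})
    (Theta : {linear tensor A B -> tensor B A} :=
       tmap fst idfun \o psi \o tmap idfun inB)
    (Upsilon : {linear tensor A C -> tensor C A} :=
       tmap snd idfun \o psi \o tmap idfun inC) :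
  twisting_map A B Theta -> twisting_map A C Upsilon ->
  (twisting_map A (B * C) psi <-> psi =1 oplus Theta Upsilon).
Proof.
move=> TB TC; split=> [P|/oplus_restricts [pB pC]].
  by apply/oplus_restricts; apply: restricts_of_twisting.
exact: twisting_of_restricts TB TC pB pC.
Qed.
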